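(* Let $(V,\omega)$ and $(V,\omega')$ be two vertex operator algebra structures on the same underlying vertex algebra $V$, and let $g_1,g_2,g_3$ be mutually commuting automorphisms of finite order of both structures. Let $(W_k,Y_{W_k})$ be a weak $g_k$-twisted $V$-module for $k=2,3$, and suppose $W_1$ is a lowest weight weak $g_1$-twisted $(V,\omega)$-module. Then there is a canonical isomorphism (of vector spaces) between the spaces of intertwining operators $$I_{(V,\omega)}\binom{W_3}{W_1\ W_2}\quad\text{and}\quad I_{(V,\omega')}\binom{W_3}{W_1\ W_2}.$$
   Context: All vector spaces are over $\mathbb{C}$, and $\mathbb{N}=\{0,1,2,\dots\}$. A vertex algebra is a vector space $V$ with a linear map $Y(\cdot,x):V\to(\operatorname{End}V)[[x,x^{-1}]]$, $v\mapsto Y(v,x)=\sum_{n\in\mathbb{Z}}v_nx^{-n-1}$, and a vector $\mathbf{1}\in V$ such that for all $u,v\in V$: $Y(\mathbf{1},z)=\operatorname{id}_V$ and $u_n\mathbf{1}=\delta_{n,-1}u$ for $n\ge -1$; $u_nv=0$ for $n$ sufficiently large; and the Jacobi identity $$z_0^{-1}\delta\left(\tfrac{z_1-z_2}{z_0}\right)Y(u,z_1)Y(v,z_2)-z_0^{-1}\delta\left(\tfrac{z_2-z_1}{-z_0}\right)Y(v,z_2)Y(u,z_1)=z_2^{-1}\delta\left(\tfrac{z_1-z_0}{z_2}\right)Y(Y(u,z_0)v,z_2)$$ holds, where $\delta(z)=\sum_{k\in\mathbb{Z}}z^k$ and binomials are expanded in nonnegative powers of the second variable. Put $\mathcal{D}v=v_{-2}\mathbf{1}$.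 A conformal vector of $V$ is $\omega\in V$ such that, with $L(n)=\omega_{n+1}$: $[L(m),L(n)]=(m-n)L(m+n)+\frac{m^3-m}{12}\delta_{m+n,0}c_V$ for some $c_V\in\mathbb{C}$; $L(-1)=\mathcal{D}$; $L(0)$ is semisimple, $V=\bigoplus_{n\in\mathbb{C}}V_n$ with $L(0)|_{V_n}=n\operatorname{id}$; and each $L(n)$, $n\ge1$, acts locally nilpotently. A vertex operator algebra $(V,\omega)$ is a vertex algebra with a conformal vector such that $V_n=0$ unless $n\in\mathbb{Z}$, $\dim V_n<\infty$ for all $n\in\mathbb{Z}$, and $V_n=0$ for $n$ sufficiently small. For $u\in V_n$, $\operatorname{wt}u=n$. An automorphism of $(V,\omega)$ is a linear isomorphism $g$ with $g(\mathbf{1})=\mathbf{1}$, $g(Y(u,z)v)=Y(g(u),z)g(v)$ and $g(\omega)=\omega$. For an automorphism $g$ of finite order $T$, $V=\bigoplus_{r=0}^{T-1}V^r$ with $V^r=\{v\in V\mid gv=e^{-2\pi\sqrt{-1}r/T}v\}$. A weak $g$-twisted $V$-module is a vector space $M$ with a linear map $Y_M(\cdot,z):V\to(\operatorname{End}M)[[z^{1/T},z^{-1/T}]]$, with $Y_M(u,z)=\sum_{n\in r/T+\mathbb{Z}}u_nz^{-n-1}$ for $u\in V^r$, $0\le r\le T-1$, such that: $Y_M(\mathbf{1},z)=\operatorname{id}_M$; for $u\in V^r$, $w\in M$, $u_{r/T+n}w=0$ for $n$ sufficiently large; and for $u\in V^r$, $v\in V$, $$z_0^{-1}\delta\left(\tfrac{z_1-z_2}{z_0}\right)Y_M(u,z_1)Y_M(v,z_2)-z_0^{-1}\delta\left(\tfrac{z_2-z_1}{-z_0}\right)Y_M(v,z_2)Y_M(u,z_1)=z_2^{-1}\left(\tfrac{z_1-z_0}{z_2}\right)^{-r/T}\delta\left(\tfrac{z_1-z_0}{z_2}\right)Y_M(Y(u,z_0)v,z_2).$$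 Write $Y_M(\omega,z)=\sum_{n\in\mathbb{Z}}L_M(n)z^{-n-2}$. The algebra $A_g(V,\omega)$: for $r\in\{0,\dots,T-1\}$ put $\epsilon_r=1$ if $r=0$ and $\epsilon_r=0$ if $r>0$. For homogeneous $u\in V^r$, $v\in V$ put $u\circ_gv=\operatorname{Res}_z\frac{(1+z)^{\operatorname{wt}u-1+\epsilon_r+r/T}}{z^{1+\epsilon_r}}Y(u,z)v$, and $u*_gv=\operatorname{Res}_z\frac{(1+z)^{\operatorname{wt}u}}{z}Y(u,z)v$ if $r=0$, $u*_gv=0$ if $r>0$ ($\operatorname{Res}_z$ is the coefficient of $z^{-1}$). Then $A_g(V,\omega)=V/O_g(V)$, where $O_g(V)$ is the span of all $u\circ_gv$ and $L(-1)u+L(0)u$; it is an associative algebra under $*_g$. For a weak $g$-twisted module $M$, a homogeneous $v\in V$ acts by $o(v)=v_{\operatorname{wt}v-1}$ on vectors killed by all $u_{\operatorname{wt}u-1+i}$ with $u\in V$ homogeneous and $i\in(1/T)\mathbb{Z}$, $i>0$, making the space of such vectors an $A_g(V,\omega)$-module. A lowest weight weak $g$-twisted $(V,\omega)$-module is a weak $g$-twisted $V$-module $W$ such that $W=\bigoplus_{n\in(1/T)\mathbb{N}}W_{(\lambda+n)}$ for some $\lambda\in\mathbb{C}$, where $W_{(\lambda+n)}=\{w\in W\mid L_W(0)w=(\lambda+n)w\}$, and $W_{(\lambda)}$ is an irreducible $A_g(V,\omega)$-module (under the action $v\mapsto o(v)$) and generates $W$ as a weak $g$-twisted $V$-module.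 Intertwining operators: let $g_1,g_2,g_3$ be mutually commuting automorphisms with $g_k^T=1$, and put $V^{(j_1,j_2)}=\{v\in V\mid g_kv=e^{-2\pi\sqrt{-1}j_k/T}v,\ k=1,2\}$ for $j_1,j_2\in\mathbb{Z}$. Let $(M_k,Y_{M_k})$ be a weak $g_k$-twisted $V$-module, $k=1,2,3$. An intertwining operator of type $\binom{M_3}{M_1\ M_2}$ for $(V,\omega)$ is a linear map $\mathcal{Y}(\cdot,x):M_1\to(\operatorname{Hom}(M_2,M_3))\{x\}$, $w\mapsto\mathcal{Y}(w,x)=\sum_{h\in\mathbb{C}}w_hx^{-h-1}$, such that: (1) for $w^{(1)}\in M_1$, $w^{(2)}\in M_2$, $h\in\mathbb{C}$, $w^{(1)}_{h+n}w^{(2)}=0$ for $n\in\mathbb{Q}$ sufficiently large; (2) for $v\in V^{(j_1,j_2)}$, $j_1,j_2\in\mathbb{Z}$, and $w^{(1)}\in M_1$, on $M_2$, $$x_0^{-1}\left(\tfrac{x_1-x_2}{x_0}\right)^{\frac{j_1}{T}}\delta\left(\tfrac{x_1-x_2}{x_0}\right)Y_{M_3}(v,x_1)\mathcal{Y}(w^{(1)},x_2)-e^{\frac{j_1}{T}\pi\sqrt{-1}}x_0^{-1}\left(\tfrac{x_2-x_1}{x_0}\right)^{\frac{j_1}{T}}\delta\left(\tfrac{x_2-x_1}{-x_0}\right)\mathcal{Y}(w^{(1)},x_2)Y_{M_2}(v,x_1)$$ $$=x_2^{-1}\left(\tfrac{x_1-x_0}{x_2}\right)^{-\frac{j_2}{T}}\delta\left(\tfrac{x_1-x_0}{x_2}\right)\mathcal{Y}(Y_{M_1}(v,x_0)w^{(1)},x_2);$$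 (3) $\mathcal{Y}(L_{M_1}(-1)w^{(1)},x)=\frac{d}{dx}\mathcal{Y}(w^{(1)},x)$ for $w^{(1)}\in M_1$, where $L_{M_1}(-1)$ is the component operator of $Y_{M_1}(\omega,x)$. $I_{(V,\omega)}\binom{M_3}{M_1\ M_2}$ denotes the space of all such operators; $I_{(V,\omega')}$ is defined the same way with $\omega'$ in place of $\omega$. *)

(* Defs.v *)
From HB Require Import structures.
From mathcomp Require Import all_boot all_order all_algebra.
From mathcomp Require Import complex.
From mathcomp Require Import boolp classical_sets functions reals.
From mathcomp Require Import topology normedtype sequences trigo.

Set Implicit Arguments.
Unset Strict Implicit.
Unset Printing Implicit Defensive.

Import Order.TTheory GRing.Theory Num.Theory.
Local Open Scope classical_set_scope.
Local Open Scope complex_scope.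
Local Open Scope ring_scope.

(* The ground field is the field R[i] of complex numbers, R : realType.      *)

Definition cis (R : realType) (t : R) : R[i] := cos t +i* sin t.

Definition cbin (R : realType) (a : R[i]) (i : nat) : R[i] :=
  (\prod_(j < i) (a - j%:R)) / (i`!)%:R.

(* Equality of two sums over all i : nat each of which has finitely many     *)
(* nonzero terms.  Wherever it is used, this finiteness is a consequence of  *)
(* the truncation axioms.                                                    *)
Definition eqsum (W : zmodType) (f g : nat -> W) : Prop :=
  \forall N \near \oo, \sum_(i < N) f i = \sum_(i < N) g i.

Section Subspaces.
Context (K : pzRingType) (V : lmodType K).

Definition is_subspace (P : set V) : Prop :=
  P 0 /\ forall a u v, P u -> P v -> P (a *: u + v).

Definition lspan (S : set V) : set V :=
  [set v | forall P, is_subspace P -> S `<=` P -> P v].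
End Subspaces.

(* [vmode u n] is the operator u_n.  The Jacobi identity is given by its     *)
(* coefficients of z0^(-l-1) z1^(-m-1) z2^(-n-1).                            *)
Record vertexAlgebra (R : realType) (V : lmodType R[i]) := VertexAlgebra {
  vmode : V -> int -> V -> V;
  vac : V;
  vmode_linearl : forall n v, linear (fun u => vmode u n v);
  vmode_linearr : forall u n, linear (vmode u n);
  vmode_vacl : forall n v, vmode vac n v = if n == -1 then v else 0;
  vmode_vacr : forall u n, -1 <= n ->
    vmode u n vac = if n == -1 then u else 0;
  vmode_trunc : forall u v, exists N : int, forall n, N <= n ->
    vmode u n v = 0;
  vmode_jacobi : forall u v w (l m n : int),
    eqsum
      (fun i => ((-1) ^+ i * cbin l%:~R i) *:
         (vmode u (m + l - i%:Z) (vmode v (n + i%:Z) w)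
          - (-1) ^ l *: vmode v (n + l - i%:Z) (vmode u (m + i%:Z) w)))
      (fun i => cbin m%:~R i *:
         vmode (vmode u (l + i%:Z) v) (m + n - i%:Z) w)
}.

Section VertexOperatorAlgebras.
Context (R : realType) (V : lmodType R[i]) (A : vertexAlgebra V).

Definition Dop (v : V) : V := vmode A v (- 2) (vac A).

Definition Lop (om : V) (n : int) (v : V) : V := vmode A om (n + 1) v.

Definition wtspace (om : V) (n : R[i]) : set V :=
  [set v | Lop om 0 v = n *: v].

Definition virasoro (om : V) : Prop :=
  exists c : R[i], forall (m n : int) (v : V),
    Lop om m (Lop om n v) - Lop om n (Lop om m v) =
      (m - n)%:~R *: Lop om (m + n) v
      + (if m + n == 0 then ((m ^+ 3 - m)%:~R / 12%:R * c) *: v else 0).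

(* Eigenspaces of L(0) are always independent, so V is their direct sum as   *)
(* soon as they span V.                                                      *)
Definition conformal (om : V) : Prop :=
  [/\ virasoro om,
      forall v, Lop om (- 1) v = Dop v,
      lspan (\bigcup_n wtspace om n) = setT
    & forall (n : int) v, 1 <= n -> exists k : nat, iter k (Lop om n) v = 0].

Definition voa (om : V) : Prop :=
  [/\ conformal om,
      forall n v, wtspace om n v -> v <> 0 -> exists k : int, n = k%:~R,
      forall n : int, exists s : seq V,
        wtspace om n%:~R `<=` lspan [set` s]
    & exists N : int, forall n : int, n < N ->
        wtspace om n%:~R `<=` [set 0]].

Definition voa_aut (om : V) (g : {linear V -> V}) : Prop :=
  [/\ bijective g,
      g (vac A) = vac A,
      forall u n v, g (vmode A u n v) = vmode A (g u) n (g v)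
    & g om = om].

Definition has_order (g : V -> V) (T : nat) : Prop :=
  [/\ (0 < T)%N,
      forall v, iter T g v = v
    & forall k, (0 < k < T)%N -> ~ forall v, iter k g v = v].

(* { v | g v = exp (- 2 pi i r / T) v }                                      *)
Definition twspace (g : V -> V) (T : nat) (r : int) : set V :=
  [set v | g v = cis (- (2%:R * pi * r%:~R / T%:R)) *: v].

(* u o_g v and u *_g v, as relations for u homogeneous in V^r: the residue   *)
(* of (1+z)^a z^b Y(u,z)v is the sum over i of binom(a,i) u_(i+b) v.         *)
Definition circ_g (om : V) (g : V -> V) (T : nat) (u v s : V) : Prop :=
  exists (r : nat) (n : int), [/\ (r < T)%N, twspace g T r u,
    wtspace om n%:~R u
    & let eps : int := if r == 0%N then 1 else 0 in
      \forall N \near \oo, s = \sum_(i < N)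
        cbin ((n - 1 + eps)%:~R + r%:R / T%:R) i *:
          vmode A u (i%:Z - 1 - eps) v].

Definition star_g (om : V) (g : V -> V) (T : nat) (u v s : V) : Prop :=
  exists (r : nat) (n : int), [/\ (r < T)%N, twspace g T r u,
    wtspace om n%:~R u
    & if r == 0%N then
        \forall N \near \oo, s = \sum_(i < N)
          cbin n%:~R i *: vmode A u (i%:Z - 1) v
      else s = 0].

Definition Og (om : V) (g : V -> V) (T : nat) : set V :=
  lspan ([set s | exists u v, circ_g om g T u v s] `|`
         [set s | exists u, s = Lop om (- 1) u + Lop om 0 u]).

(* A module over A_g(V, om) = V / O_g(V), on the subspace U of M, is a       *)
(* linear action of V on U which vanishes on O_g(V), turns *_g into          *)
(* composition, and for which the class of the vacuum (the unit) acts as the *)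
(* identity.                                                                 *)
Definition Ag_module (om : V) (g : V -> V) (T : nat) (M : lmodType R[i])
    (rho : V -> M -> M) (U : set M) : Prop :=
  [/\ is_subspace U /\ (forall v w, U w -> U (rho v w)),
      (forall a u v w, U w -> rho (a *: u + v) w = a *: rho u w + rho v w) /\
      (forall v a w w', U w -> U w' ->
         rho v (a *: w + w') = a *: rho v w + rho v w'),
      forall w, U w -> rho (vac A) w = w,
      forall u v s w, U w -> star_g om g T u v s ->
        rho s w = rho u (rho v w)
    & forall s w, U w -> Og om g T s -> rho s w = 0].

Definition irreducible_Ag_module (om : V) (g : V -> V) (T : nat)
    (M : lmodType R[i]) (rho : V -> M -> M) (U : set M) : Prop :=
  [/\ Ag_module om g T rho U,
      exists2 w, U w & w <> 0
    & forall P : set M, is_subspace P -> P `<=` U ->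
        (forall v w, P w -> P (rho v w)) -> P `<=` [set 0] \/ P = U].

End VertexOperatorAlgebras.

(* Weak g-twisted modules, T being the order of g.  [tmode u n] is the       *)
(* operator u_n; n runs over R[i], the modes outside r/T + Z being zero on   *)
(* V^r.  The Jacobi identity is given by its coefficients of                 *)
(* z0^(-l-1) z1^(-m-1) z2^(-n-1), m in r/T + Z: by tmode_support no other    *)
(* powers of z1 occur in it, and no nonintegral power of z0 does.            *)
Record twistedModule (R : realType) (V : lmodType R[i]) (A : vertexAlgebra V)
    (g : V -> V) (T : nat) (M : lmodType R[i]) := TwistedModule {
  tmode : V -> R[i] -> M -> M;
  tmode_linearl : forall n w, linear (fun u => tmode u n w);
  tmode_linearr : forall u n, linear (tmode u n);
  tmode_support : forall (r : nat) u, (r < T)%N -> twspace g T r u ->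
    forall n w, (forall k : int, n <> r%:R / T%:R + k%:~R) -> tmode u n w = 0;
  tmode_vac : forall n w, tmode (vac A) n w = if n == -1 then w else 0;
  tmode_trunc : forall (r : nat) u, (r < T)%N -> twspace g T r u ->
    forall w, exists N : int, forall n : int, N <= n ->
      tmode u (r%:R / T%:R + n%:~R) w = 0;
  tmode_jacobi : forall (r : nat) u, (r < T)%N -> twspace g T r u ->
    forall v w (l k : int) (n : R[i]),
    let m : R[i] := r%:R / T%:R + k%:~R in
    eqsum
      (fun i => ((-1) ^+ i * cbin l%:~R i) *:
         (tmode u (m + l%:~R - i%:R) (tmode v (n + i%:R) w)
          - (-1) ^ l *: tmode v (n + l%:~R - i%:R) (tmode u (m + i%:R) w)))
      (fun i => cbin m i *:
         tmode (vmode A u (l + i%:Z) v) (m + n - i%:R) w)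
}.

Section TwistedModules.
Context (R : realType) (V : lmodType R[i]) (A : vertexAlgebra V).
Context (g : V -> V) (T : nat) (M : lmodType R[i]).
Context (YM : twistedModule A g T M).

Definition LM (om : V) (n : int) (w : M) : M := tmode YM om (n + 1)%:~R w.

(* o is the linear extension of v |-> v_(wt v - 1).                          *)
Definition zero_mode (om : V) (o : V -> M -> M) : Prop :=
  (forall w, linear (o^~ w)) /\
  forall (n : int) v, wtspace A om n%:~R v ->
    forall w, o v w = tmode YM v (n - 1)%:~R w.

Definition generates (U : set M) : Prop :=
  forall P : set M, is_subspace P -> U `<=` P ->
    (forall v n w, P w -> P (tmode YM v n w)) -> P = setT.

Definition Mspace (om : V) (a : R[i]) : set M := [set w | LM om 0 w = a *: w].

Definition lowest_weight (om : V) : Prop :=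
  exists (lambda : R[i]) (o : V -> M -> M),
    [/\ lspan (\bigcup_(k : nat) Mspace om (lambda + k%:R / T%:R)) = setT,
        zero_mode om o,
        irreducible_Ag_module A om g T o (Mspace om lambda)
      & generates (Mspace om lambda)].

End TwistedModules.

Section IntertwiningOperators.
Context (R : realType) (V : lmodType R[i]) (A : vertexAlgebra V).
Context (om : V) (g1 g2 g3 : V -> V) (T T1 T2 T3 : nat).
Context (M1 M2 M3 : lmodType R[i]).
Context (Y1 : twistedModule A g1 T1 M1).
Context (Y2 : twistedModule A g2 T2 M2).
Context (Y3 : twistedModule A g3 T3 M3).

(* For I : M1 -> R[i] -> M2 -> M3, [I w h] is the operator w_h.              *)

(* Coefficients of x0^(-l-1) x1^(-m-1) x2^(-n-1) of the Jacobi identity, for *)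
(* l in j1/T + Z (the only powers of x0 that occur) and all m, n.  The right *)
(* hand side contains only the powers of x1 with m in j2/T + Z.              *)
Definition iop_jacobi (I : M1 -> R[i] -> M2 -> M3) : Prop :=
  forall (j1 j2 : int) (v : V),
    twspace g1 T j1 v -> twspace g2 T j2 v ->
  forall (w1 : M1) (w2 : M2) (k : int) (m n : R[i]),
    let l : R[i] := j1%:~R / T%:R + k%:~R in
    eqsum
      (fun i => ((-1) ^+ i * cbin l i) *:
         (tmode Y3 v (m + l - i%:R) (I w1 (n + i%:R) w2)
          - (cis (j1%:~R / T%:R * pi) * (-1) ^ k) *:
              I w1 (n + l - i%:R) (tmode Y2 v (m + i%:R) w2)))
      (fun i => if `[< exists k' : int, m = j2%:~R / T%:R + k'%:~R >]
         then cbin m i *: I (tmode Y1 v (l + i%:R) w1) (m + n - i%:R) w2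
         else 0).

Definition intertwining (I : M1 -> R[i] -> M2 -> M3) : Prop :=
  [/\ (forall h w2, linear (fun w1 => I w1 h w2)) /\
      (forall w1 h, linear (I w1 h)),
      forall w1 w2 h, exists N : rat, forall n : rat, N <= n ->
        I w1 (h + ratr n) w2 = 0,
      iop_jacobi I
    & forall w1 h w2, I (LM Y1 om (- 1) w1) h w2 = - h *: I w1 (h - 1) w2].

Definition iop_pred : {pred M1 -> R[i] -> M2 -> M3} :=
  fun I => `[< intertwining I >].

Lemma iop_submod_closed : submod_closed iop_pred.
Proof.
have z w h x : (0 : M1 -> R[i] -> M2 -> M3) w h x = 0 by [].
have lc a (I J : M1 -> R[i] -> M2 -> M3) w h x :
  (a *: I + J) w h x = a *: I w h x + J w h x by [].
split=> [|a I J /asboolP[[I1 I2] I3 I4 I5] /asboolP[[J1 J2] J3 J4 J5]];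
  apply/asboolP.
  split.
  - by split=> *; move=> a u v; rewrite !z scaler0 addr0.
  - by move=> *; exists 0.
  - move=> j1 j2 v _ _ w1 w2 k m n l; apply: nearW => N.
    have tz u p : tmode Y3 u p 0 = 0.
      have := tmode_linearr Y3 u p (- 1) 0 0.
      by rewrite scaler0 addr0 scaleN1r addNr.
    transitivity (0 : M3); [|symmetry]; apply: big1 => i _.
      by rewrite !z tz scaler0 subr0 scaler0.
    by case: ifP => _; rewrite ?z ?scaler0.
  - by move=> *; rewrite !z scaler0.
split.
- split=> [h w2|w1 h] b u v.
    by rewrite !lc (I1 h w2 b u v) (J1 h w2 b u v) !scalerDr !scalerA
      (mulrC a b) addrACA.
  by rewrite !lc (I2 w1 h b u v) (J2 w1 h b u v) !scalerDr !scalerA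
    (mulrC a b) addrACA.
- move=> w1 w2 h; have [N1 N1P] := I3 w1 w2 h; have [N2 N2P] := J3 w1 w2 h.
  exists (Num.max N1 N2) => n; rewrite ge_max => /andP[n1 n2].
  by rewrite lc N1P// N2P// scaler0 addr0.
- move=> j1 j2 v v1 v2 w1 w2 k m n l.
  apply: filterS2 (I4 j1 j2 v v1 v2 w1 w2 k m n)
                  (J4 j1 j2 v v1 v2 w1 w2 k m n) => N.
  rewrite -/l => eI eJ.
  have {eI eJ} := congr2 (fun x y => a *: x + y) eI eJ.
  rewrite !scaler_sumr -!big_split /= => eIJ.
  apply: etrans (etrans eIJ _); apply: eq_bigr => i _; last first.
    by case: ifP => _; rewrite ?scaler0 ?addr0// lc scalerDr !scalerA (mulrC a).
  rewrite !lc (tmode_linearr Y3).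
  have sw (x y : R[i]) (t : M3) : x *: (y *: t) = y *: (x *: t).
    by rewrite !scalerA mulrC.
  rewrite sw -[RHS]scalerDr; congr (_ *: _).
  by rewrite scalerBr [in LHS]scalerDr opprD [in LHS]sw addrACA.
- by move=> w1 h w2; rewrite !lc I5 J5 scalerDr !scalerA (mulrC a).
Qed.

HB.instance Definition _ :=
  GRing.isSubmodClosed.Build _ _ iop_pred iop_submod_closed.

(* The vector space of intertwining operators of type (M3; M1 M2).           *)
Record iop_space := IopSpace {
  iop_fun :> M1 -> R[i] -> M2 -> M3;
  _ : iop_fun \in iop_pred
}.

HB.instance Definition _ := [isSub for iop_fun].
HB.instance Definition _ := [Choice of iop_space by <:].
HB.instance Definition _ := [SubChoice_isSubLmodule of iop_space by <:].

End IntertwiningOperators.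

Arguments iop_space {R V A} om {g1 g2 g3} T {T1 T2 T3 M1 M2 M3} Y1 Y2 Y3.

(* Main.v *)
Require Import Defs.
From HB Require Import structures.
From mathcomp Require Import all_boot all_order all_algebra.
From mathcomp Require Import complex finmap.
From mathcomp Require Import boolp classical_sets functions reals.
From mathcomp Require Import topology normedtype sequences trigo.
From mathcomp Require Import cardinality ereal measure lebesgue_measure.
From mathcomp Require Import lra ring zify.

Set Implicit Arguments.
Unset Strict Implicit.
Unset Printing Implicit Defensive.

Import Order.TTheory GRing.Theory Num.Theory.
Local Open Scope classical_set_scope.
Local Open Scope complex_scope.
Local Open Scope ring_scope.

(** The two translation operators differ by a scalar on the first module, and
    a scalar is undone by an exponential.

    Put [a = om' - om].  On [V] both conformal vectors have [L(-1) = D], so the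
    mode [a_0] vanishes on [V].  The commutator formula
    [[a_0, Y(v, z)] = Y(a_0 v, z)] then makes [a_0] commute with every mode of
    every vector on the twisted module [W1] ([central_mode_comm]).  In
    particular it commutes with [L(0)], hence preserves the lowest weight
    space [U], and it commutes there with the action of the zero modes, which
    is irreducible.  The space [U] may well be infinite-dimensional, but it has
    countable dimension: [V] has a countable spanning family
    ([voa_countable]), and [U] is the image of [V] under [v |-> o(v) w] for any
    nonzero [w] in [U] ([irreducible_cyclic]).  Over the complex numbers, which
    are algebraically closed and uncountable, Dixmier's form of Schur's lemma
    ([spectrum_nonempty], [schur_countable]) says that [a_0] is a scalar [c] on
    [U].  Since [U] generates [W1], [a_0] is [c] on all of [W1]
    ([lowest_weight_scalar]), that is, [L'(-1) = L(-1) + c].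

    The isomorphism sends [I(w, x)] to [exp(c x) I(w, x)].  The factor
    [exp(c x2)] multiplies all three terms of the Jacobi identity
    ([iop_jacobi_twist]), while the product rule adds [c] to the derivative,
    which is the change from [L(-1)] to [L'(-1)] ([intertwining_twist]).  The
    inverse is multiplication by [exp(- c x)] ([exp_twistD], [exp_twist0]).
    On coefficients, [exp(c x) I] is given by the sums over [k] of
    [c^k / k! I_(h+k)], and the truncation axiom leaves finitely many nonzero
    terms in each. *)

(** * Linear maps and spans *)

(** The modes are linear in each variable separately, in the form of a
    proposition about a bare function; these rules apply to that form. *)
Section LinearMaps.
Context (K : pzRingType) (M N : lmodType K) (f : M -> N) (lf : linear f).

Lemma lin0 : f 0 = 0.
Proof. by have := lf (-1) 0 0; rewrite scaler0 addr0 scaleN1r addNr. Qed.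

Lemma linZ a u : f (a *: u) = a *: f u.
Proof. by have := lf a u 0; rewrite !addr0 lin0 addr0. Qed.

Lemma linD u v : f (u + v) = f u + f v.
Proof. by have := lf 1 u v; rewrite !scale1r. Qed.

Lemma linN u : f (- u) = - f u.
Proof. by rewrite -scaleN1r linZ scaleN1r. Qed.

Lemma linB u v : f (u - v) = f u - f v.
Proof. by rewrite linD linN. Qed.

Lemma lin_sum (I : Type) (r : seq I) (P : pred I) (F : I -> M) :
  f (\sum_(i <- r | P i) F i) = \sum_(i <- r | P i) f (F i).
Proof. exact: (big_morph f linD lin0). Qed.
End LinearMaps.

Section Subspaces.
Context (K : pzRingType) (V : lmodType K).

Section Closure.
Context (P : set V) (sP : is_subspace P).

Lemma subspZ a u : P u -> P (a *: u).
Proof. by move=> Pu; rewrite -[_ *: _]addr0; apply: sP.2 => //; exact: sP.1. Qed.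

Lemma subspD u v : P u -> P v -> P (u + v).
Proof. by move=> Pu Pv; rewrite -[u]scale1r; exact: sP.2. Qed.

Lemma subspB u v : P u -> P v -> P (u - v).
Proof. by move=> Pu Pv; rewrite addrC -scaleN1r; exact: sP.2. Qed.

Lemma subsp_sum (I : Type) (r : seq I) (Q : pred I) (F : I -> V) :
  (forall i, Q i -> P (F i)) -> P (\sum_(i <- r | Q i) F i).
Proof. by move=> PF; elim/big_ind : _ => //; [exact: sP.1|exact: subspD]. Qed.
End Closure.

Lemma sub_lspan (S : set V) : S `<=` lspan S.
Proof. by move=> x Sx P _; exact. Qed.

Lemma lspan_subspace (S : set V) : is_subspace (lspan S).
Proof.
split=> [P sP _|a u v uS vS P sP SP]; first exact: sP.1.
by apply: sP.2; [exact: uS|exact: vS].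
Qed.

Lemma lspan_mono (S S' : set V) : S `<=` S' -> lspan S `<=` lspan S'.
Proof. by move=> SS x xS P sP S'P; apply: xS => // y /SS /S'P. Qed.

Lemma lspan_seq_coords (s : seq V) x : lspan [set` s] x ->
  exists c : 'I_(size s) -> K, x = \sum_i c i *: s`_i.
Proof.
move=> xs; apply: (xs [set y | exists c : 'I_(size s) -> K, y = \sum_i c i *: s`_i]);
  last first.
  move=> y /= ys; have ix : (index y s < size s)%N by rewrite index_mem.
  exists (fun i => (i == Ordinal ix)%:R).
  rewrite (bigD1 (Ordinal ix))//= eqxx scale1r nth_index// big1 ?addr0//.
  by move=> i /negbTE ->; rewrite scale0r.
split; first by exists (fun=> 0); rewrite big1// => i _; rewrite scale0r.
move=> a u v [c ->] [d ->]; exists (fun i => a * c i + d i).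
rewrite scaler_sumr -big_split/=; apply: eq_bigr => i _.
by rewrite scalerA scalerDl.
Qed.

End Subspaces.

Lemma lspan_image (K : pzRingType) (V N : lmodType K) (f : V -> N) (S : set V) x :
  linear f -> lspan S x -> lspan (f @` S) (f x).
Proof.
move=> lf xS; apply: (xS [set y | lspan (f @` S) (f y)]); last first.
  by move=> y Sy; rewrite /=; apply: sub_lspan; exists y.
have [l0 l1] := lspan_subspace (f @` S).
split=> [|a u v]; rewrite /= ?(lin0 lf)//.
by rewrite lf; exact: l1.
Qed.

(** * Countable-dimensional Schur lemma *)

(** The action [p(f) w] of a polynomial in the operator [f]. *)
Definition poly_act (K : nzRingType) (M : lmodType K) (f : M -> M)
  (p : {poly K}) (w : M) : M := \sum_(i < size p) p`_i *: iter i f w.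

Section PolyAct.
Context (K : fieldType) (M : lmodType K) (f : M -> M) (lf : linear f).
Implicit Types (p q : {poly K}) (w : M).

Lemma poly_act_wide n p w : (size p <= n)%N ->
  poly_act f p w = \sum_(i < n) p`_i *: iter i f w.
Proof.
move=> pn; rewrite /poly_act (big_ord_widen n (fun i => p`_i *: iter i f w))//.
rewrite big_mkcond; apply: eq_bigr => i _; case: ifPn => //.
by rewrite -leqNgt => /(nth_default 0) ->; rewrite scale0r.
Qed.

Lemma poly_act_linearl w : linear (fun p => poly_act f p w).
Proof.
move=> a p q; pose n := maxn (size p) (size q).
rewrite [poly_act f p w](@poly_act_wide n) ?leq_maxl//.
rewrite [poly_act f q w](@poly_act_wide n) ?leq_maxr//.
rewrite (@poly_act_wide n); last first.
  rewrite (leq_trans (size_polyD _ _))// geq_max leq_maxr andbT.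
  by rewrite (leq_trans (size_scale_leq _ _))// leq_maxl.
rewrite scaler_sumr -big_split/=; apply: eq_bigr => i _.
by rewrite coefD coefZ scalerDl scalerA.
Qed.

Lemma iter_linear n : linear (iter n f).
Proof. by elim: n => [//|n ih] a u v; rewrite /= ih lf. Qed.

Lemma poly_act_linear p : linear (poly_act f p).
Proof.
move=> a u v; rewrite /poly_act scaler_sumr -big_split/=.
apply: eq_bigr => i _; rewrite iter_linear scalerDr !scalerA.
by rewrite [p`_i * a]mulrC.
Qed.

Lemma poly_act1 w : poly_act f 1 w = w.
Proof. by rewrite /poly_act size_poly1 big_ord1 coef1 scale1r. Qed.

Lemma poly_actMX p w : poly_act f (p * 'X) w = poly_act f p (f w).
Proof.
rewrite (@poly_act_wide (size p).+1); last first.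
  by rewrite (leq_trans (size_polyMleq _ _))// size_polyX addn2.
rewrite big_ord_recl coefMX scale0r add0r; apply: eq_bigr => i _.
by rewrite coefMX/= -iterS iterSr.
Qed.

Lemma poly_actMXsubC p s w :
  poly_act f (p * ('X - s%:P)) w = poly_act f p (f w - s *: w).
Proof.
rewrite mulrBr (linB (poly_act_linearl w)) poly_actMX mulrC mul_polyC.
by rewrite (linZ (poly_act_linearl w)) (linB (poly_act_linear p))
  (linZ (poly_act_linear p)).
Qed.

(** Each factor [f - z] maps [U] injectively to itself, hence so does their
    product. *)
Lemma poly_act_prod_neq0 (U : set M) (rs : seq K) w :
  is_subspace U -> (forall x, U x -> U (f x)) ->
  (forall t x, U x -> f x = t *: x -> x = 0) ->
  U w -> w <> 0 -> poly_act f (\prod_(z <- rs) ('X - z%:P)) w <> 0.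
Proof.
move=> sU fU inj; elim: rs w => [|z rs ih] w Uw w0.
  by rewrite big_nil poly_act1.
rewrite big_cons mulrC poly_actMXsubC; apply: ih.
  by apply: subspB => //; [exact: fU|exact: subspZ].
by move=> /eqP; rewrite subr_eq0 => /eqP /(inj _ _ Uw).
Qed.

End PolyAct.

(** Otherwise the real line would be a countable union of finite sets, hence
    negligible for the Lebesgue measure. *)
Lemma uncountable_fiber (R : realType) (F : R -> nat) :
  exists n, infinite_set [set t | F t = n].
Proof.
apply: contrapT => /forallNP fin.
have cT : countable [set: R].
  have -> : [set: R] = \bigcup_n [set t | F t = n].
    by apply/seteqP; split=> // t _; exists (F t).
  by apply: bigcup_countable => // n _; apply: finite_set_countable;
    apply: contrapT; exact: fin.
have := countable_lebesgue_measure0 cT.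
have le01 : (lebesgue_measure `[0%R, 1%R]%classic <= lebesgue_measure [set: R])%E.
  by apply: le_measure => //; rewrite inE//; exact: measurable_itv.
move=> e0; move: le01; rewrite e0 lebesgue_measure_itv/= lte_fin ltr01.
by rewrite -EFinB lee_fin subr0 ler10.
Qed.

(** Dixmier's argument.  If every [f - t] were bijective on [U], the
    preimages [x_t] of a fixed [w] under [f - t] would be uncountably many
    vectors in a space of countable dimension, so for finitely many distinct
    [t_i] there is a relation [\sum_i c_i x_(t_i) = 0].  Clearing denominators
    in [\sum_i c_i / (f - t_i) w = 0] gives [p(f) w = 0] for a nonzero
    polynomial [p]; but [p] splits into linear factors, all injective. *)
Lemma spectrum_nonempty (R : realType) (M : lmodType R[i]) (f : M -> M)
    (U : set M) (S : nat -> seq M) :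
  linear f -> is_subspace U -> (forall x, U x -> U (f x)) ->
  (exists2 w, U w & w <> 0) -> U `<=` \bigcup_n lspan [set` S n] ->
  exists t, (exists x, [/\ U x, x <> 0 & f x = t *: x]) \/
    (exists2 y, U y & forall x, U x -> f x - t *: x <> y).
Proof.
move=> lf sU fU [w Uw w0] US; apply: contrapT => /forallNP spec.
have inj t x : U x -> f x = t *: x -> x = 0.
  move=> Ux fx; apply: contrapT => x0; apply: (spec t); left.
  by exists x.
have surj (t : R) : exists x, U x /\ f x - t%:C *: x = w.
  apply: contrapT => /forallNP nx; apply: (spec t%:C); right.
  by exists w => // x Ux fx; exact: (nx x).
have {surj}[x xP] := choice surj.
have cov (t : R) : exists n, lspan [set` S n] (x t).
  by have [n _ ?] := US _ (xP t).1; exists n.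
have {cov}[F FP] := choice cov.
(* Infinitely many [x t] lie in the span of one finite list; more of them than
   its length are linearly dependent. *)
have [n infF] := uncountable_fiber F.
pose s := S n; pose d := size s.
have [X XF dX] := infinite_set_fset d.+1 infF.
pose ts := take d.+1 (enum_fset X).
have szts : size ts = d.+1 by rewrite size_takel.
have uts : uniq ts by rewrite take_uniq ?fset_uniq.
have tsF i : (i < d.+1)%N -> F ts`_i = n.
  move=> id; apply: XF => /=; apply: (@mem_take d.+1).
  by rewrite mem_nth// szts.
pose t (i : 'I_d.+1) : R[i] := (ts`_i)%:C.
have t_inj i j : t i = t j -> i = j.
  move=> /complexI /eqP; rewrite nth_uniq ?szts// => /eqP ij; exact: val_inj.
have /choice[C CP] (i : 'I_d.+1) : exists c : 'I_d -> R[i],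
    x ts`_i = \sum_j c j *: s`_j.
  by apply: lspan_seq_coords; rewrite /s -(tsF i (ltn_ord i)).
have [c c0 cC] : exists2 c : 'rV[R[i]]_d.+1, c != 0 & c *m (\matrix_(i, j) C i j) = 0.
  set A := (\matrix_(i, j) C i j).
  have : kermx A != 0.
    rewrite kermx_eq0 /row_free; apply: contraL (rank_leq_col A) => /eqP ->.
    by rewrite -ltnNge.
  move=> /rowV0Pn[c cA c0]; exists c => //.
  by apply/sub_kermxP.
have dep : \sum_i c 0 i *: x ts`_i = 0.
  under eq_bigr do rewrite CP scaler_sumr.
  rewrite exchange_big/= big1// => j _.
  under eq_bigr do rewrite scalerA.
  rewrite -scaler_suml; have /matrixP/(_ 0 j) := cC; rewrite !mxE => e.
  by rewrite (_ : \sum_i _ = 0) ?scale0r// -[RHS]e; apply: eq_bigr => i _; rewrite mxE.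
pose Q i : {poly R[i]} := \prod_(j | j != i) ('X - (t j)%:P).
pose p := \sum_i c 0 i *: Q i.
have [i ci] : exists i, c 0 i != 0.
  apply: contrapT => /forallNP h; move/eqP: c0; apply; apply/rowP => i.
  by rewrite mxE; apply/eqP; apply/negPn/negP; exact: h.
(* At [t i] only the summand of [p] lacking the factor ['X - t i] survives. *)
have pE : p.[t i] = c 0 i * \prod_(j | j != i) (t i - t j).
  rewrite /p horner_sum (bigD1 i)//= [X in _ + X]big1 ?addr0.
    rewrite hornerZ horner_prod; congr (_ * _).
    by apply: eq_bigr => j _; rewrite hornerXsubC.
  move=> j ji; rewrite hornerZ horner_prod (bigD1 i) 1?eq_sym//=.
  by rewrite hornerXsubC subrr mul0r mulr0.
have p0 : p != 0.
  apply: contra_neq ci => p0; move: pE; rewrite p0 horner0 => /esym/eqP.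
  rewrite mulf_eq0 => /orP[/eqP //|/prodf_eq0[j ji]].
  by rewrite subr_eq0 => /eqP /t_inj e; rewrite e eqxx in ji.
have pw : poly_act f p w = 0.
  (* [f - t j] turns [x ts`_j] into [w], so [Q j] acts on [w] as the full product
     acts on [x ts`_j]. *)
  pose Qa := \prod_j ('X - (t j)%:P) : {poly R[i]}.
  have QE j : poly_act f (Q j) w = poly_act f Qa (x ts`_j).
    by rewrite /Qa (bigD1 j)//= mulrC poly_actMXsubC// (xP _).2.
  rewrite /p (lin_sum (poly_act_linearl f w)).
  transitivity (\sum_i poly_act f Qa (c 0 i *: x ts`_i)).
    apply: eq_bigr => j _.
    by rewrite (linZ (poly_act_linearl f w)) QE (linZ (poly_act_linear lf Qa)).
  by rewrite -(lin_sum (poly_act_linear lf Qa)) dep (lin0 (poly_act_linear lf Qa)).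
have [rs pE'] := closed_field_poly_normal p.
have := poly_act_prod_neq0 (rs := rs) lf sU fU inj Uw w0.
apply; move/eqP: pw; rewrite pE' (linZ (poly_act_linearl f w)) scaler_eq0.
by rewrite lead_coef_eq0 (negbTE p0) => /eqP.
Qed.

(** The predicate [stable] stands for invariance under an irreducible family of
    operators commuting with [f].  A point [t] of the spectrum makes either the
    kernel of [f - t] nonzero or its image proper; irreducibility turns both
    into [f = t]. *)
Lemma schur_countable (R : realType) (M : lmodType R[i]) (f : M -> M)
    (U : set M) (S : nat -> seq M) (stable : set M -> Prop) :
  linear f -> is_subspace U -> (forall x, U x -> U (f x)) ->
  (exists2 w, U w & w <> 0) -> U `<=` \bigcup_n lspan [set` S n] ->
  (forall P, is_subspace P -> P `<=` U -> stable P ->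
     P `<=` [set 0] \/ P = U) ->
  (forall t, stable [set x | U x /\ f x = t *: x]) ->
  (forall t, stable [set f x - t *: x | x in U]) ->
  exists t, forall x, U x -> f x = t *: x.
Proof.
move=> lf sU fU U0 US irr stK stI.
have [t] := spectrum_nonempty lf sU fU U0 US.
have sK : is_subspace [set x | U x /\ f x = t *: x].
  split=> [|a u v [Uu fu] [Uv fv]] /=.
    by rewrite (lin0 lf) scaler0; split => //; exact: sU.1.
  split; first exact: sU.2.
  by rewrite lf fu fv scalerDr !scalerA mulrC.
have sI : is_subspace [set f x - t *: x | x in U].
  split=> [|a _ _ [u Uu <-] [v Uv <-]] /=.
    by exists 0; [exact: sU.1|rewrite (lin0 lf) scaler0 subr0].
  exists (a *: u + v); first exact: sU.2.
  by rewrite lf scalerDr scalerBr !scalerA [t * a]mulrC opprD addrACA.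
case=> [[x [Ux x0 fx]]|[y Uy ny]]; exists t.
- have [|K0|KU] := irr _ sK _ (stK t); first by move=> ? [].
    by case: x0; exact: K0.
  by move=> z; rewrite -KU => -[].
- have [|K0|KU] := irr _ sI _ (stI t).
  + by move=> _ [z Uz <-]; apply: subspB => //; [exact: fU|exact: subspZ].
  + by move=> z Uz; apply/eqP; rewrite -subr_eq0; apply/eqP/K0; exists z.
  + by move: Uy; rewrite -KU => -[z Uz /(ny z Uz)].
Qed.

(** * Eigenspaces of an automorphism of finite order *)

Section RootsOfUnity.
Context (R : realType).

Lemma cis0 : cis 0 = 1 :> R[i].
Proof. by rewrite /cis cos0 sin0. Qed.

Lemma cisD (a b : R) : cis (a + b) = cis a * cis b.
Proof. by rewrite /cis cosD sinD; congr (_ +i* _); rewrite addrC. Qed.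

Lemma cisMn (a : R) n : cis (a *+ n) = cis a ^+ n.
Proof.
by elim: n => [|n ih]; rewrite ?mulr0n ?cis0 ?expr0// mulrS cisD ih exprS.
Qed.

Lemma cis_neq1 (a : R) : 0 < a < pi *+ 2 -> cis a != 1.
Proof.
move=> /andP[a0 a2pi]; apply/negP => /eqP[ca _].
have ha : a = (a / 2%:R) *+ 2 by rewrite -mulr_natr divfK// pnatr_eq0.
move: ca; rewrite ha cos_mulr2n cos2sin2 => h.
have s0 : 0 < sin (a / 2%:R).
  apply: sin_gt0_pi; rewrite divr_gt0// ltr_pdivrMr ?ltr0n//.
  by rewrite mulr_natr.
have : sin (a / 2%:R) ^+ 2 = 0 by lra.
by move=> /eqP; rewrite expf_eq0/= gt_eqF.
Qed.

Definition zeta (T : nat) : R[i] := cis (2%:R * pi / T%:R).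

Lemma zetaX T r : zeta T ^+ r = cis (2%:R * pi * r%:R / T%:R).
Proof.
by rewrite /zeta -cisMn -[_ *+ r]mulr_natr; congr cis; rewrite mulrAC.
Qed.

Lemma zeta_expT T : (0 < T)%N -> zeta T ^+ T = 1.
Proof.
move=> T0; rewrite zetaX mulfK ?pnatr_eq0 -?lt0n// /cis mulr_natl.
by rewrite cos2pi sin2pi.
Qed.

Lemma zetaX_neq1 T k : (0 < k < T)%N -> zeta T ^+ k != 1.
Proof.
move=> /andP[k0 kT]; have T0 : (0 < T)%N by rewrite (leq_trans _ kT).
rewrite zetaX; apply: cis_neq1; rewrite divr_gt0 ?mulr_gt0 ?pi_gt0 ?ltr0n//=.
rewrite ltr_pdivrMr ?ltr0n// -[pi *+ 2]mulr_natl ltr_pM2l ?ltr_nat//.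
by rewrite mulr_gt0 ?pi_gt0.
Qed.

Lemma sum_zeta T k : (k < T)%N ->
  \sum_(r < T) zeta T ^+ (r * k) = (if k == 0%N then T%:R else 0).
Proof.
move=> kT; case: eqP => [->|/eqP k0].
  under eq_bigr do rewrite muln0 expr0.
  by rewrite sumr_const card_ord.
have T0 : (0 < T)%N by rewrite (leq_trans _ kT).
have k1 : zeta T ^+ k - 1 != 0 by rewrite subr_eq0 zetaX_neq1// lt0n k0.
apply: (mulfI k1); rewrite mulr0.
under eq_bigr do rewrite mulnC exprM.
by rewrite -subrX1 -exprM mulnC exprM zeta_expT// expr1n subrr.
Qed.

End RootsOfUnity.

Section EigenDecomposition.
Context (R : realType) (V : lmodType R[i]) (g : {linear V -> V}) (T : nat).
Hypotheses (T0 : (0 < T)%N) (gT : forall v, iter T g v = v).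
Local Notation zeta := (zeta R T).

(** The projection to the eigenspace of [zeta ^- r], by Fourier inversion on the
    cyclic group generated by [g]. *)
Definition eigenproj (r : nat) (v : V) : V :=
  T%:R^-1 *: \sum_(k < T) zeta ^+ (r * k) *: iter k g v.

Lemma eigenproj_twspace (r : nat) v : twspace g T r (eigenproj r v).
Proof.
have zu n : zeta ^+ n \is a GRing.unit.
  by rewrite unitrX// -(unitrX_pos _ T0) zeta_expT// unitr1.
rewrite /twspace/= /eigenproj linearZ linear_sum/= scalerA mulrC -scalerA.
congr (_ *: _).
have -> : cis (- (2%:R * pi * r%:~R / T%:R)) = (zeta ^+ r)^-1 :> R[i].
  apply: (mulIr (zu r)); rewrite mulVr ?zu// zetaX -cisD.
  by rewrite addNr cis0.
apply: (scalerI (a := zeta ^+ r)); first by apply: contraTneq (zu r) => ->; rewrite unitr0.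
rewrite scalerA mulrV ?zu// scale1r scaler_sumr.
pose h k := zeta ^+ (r * k) *: iter k g v.
transitivity (\sum_(k < T) h k.+1).
  apply: eq_bigr => k _; by rewrite linearZ/= scalerA -exprD /h mulnS.
(* Reindexing by [k |-> k + 1] is a cyclic shift, since [h T = h 0]. *)
have : \sum_(k < T.+1) h k = \sum_(k < T.+1) h k by [].
rewrite {1}big_ord_recl big_ord_recr/=.
have -> : h T = h 0%N.
  by rewrite /h gT mulnC exprM zeta_expT// expr1n muln0 expr0.
by rewrite addrC => /addrI.
Qed.

Lemma sum_eigenproj v : v = \sum_(r < T) eigenproj r v.
Proof.
rewrite -scaler_sumr exchange_big/=.
under eq_bigr => k _ do rewrite -scaler_suml sum_zeta//.
rewrite (bigD1 (Ordinal T0))//= big1 => [|k k0]; last first.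
  by rewrite ifN ?scale0r//; apply: contraNneq k0 => k0; apply/eqP/val_inj.
by rewrite addr0 scalerA mulVf ?scale1r// pnatr_eq0 -lt0n.
Qed.

Lemma eigenproj_stable (P : set V) r v : is_subspace P ->
  (forall u, P u -> P (g u)) -> P v -> P (eigenproj r v).
Proof.
move=> sP gP Pv; apply: subspZ => //; apply: subsp_sum => // k _.
by apply: subspZ => //; elim: (k : nat) => //= n; exact: gP.
Qed.

End EigenDecomposition.

(** * Sums with finitely many nonzero terms *)

Section EventuallyEqualSums.
Context (W : zmodType).
Implicit Types f g : nat -> W.

Lemma sum_stab f N0 N : (forall i, (N0 <= i)%N -> f i = 0) -> (N0 <= N)%N ->
  \sum_(i < N) f i = \sum_(i < N0) f i.
Proof.
move=> f0 N0N; rewrite -(big_mkord xpredT f) (big_cat_nat _ (n := N0))//=.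
rewrite big_mkord [X in _ + X]big_nat_cond [X in _ + X]big1 ?addr0//.
by move=> i /andP[/andP[/f0]].
Qed.

Lemma eqsum_at N0 f g : (forall i, (N0 <= i)%N -> f i = 0) ->
  (forall i, (N0 <= i)%N -> g i = 0) -> eqsum f g ->
  \sum_(i < N0) f i = \sum_(i < N0) g i.
Proof.
move=> f0 g0 [N _ NP]; pose K := maxn N N0.
have KN0 : (N0 <= K)%N by rewrite leq_maxr.
by rewrite -(sum_stab f0 KN0) -(sum_stab g0 KN0); apply: NP; rewrite /= leq_maxl.
Qed.
End EventuallyEqualSums.

Section FiniteSums.
Context (K : pzRingType) (W : lmodType K).
Implicit Types f h : nat -> W.

Definition eventually0 f := exists N, forall i, (N <= i)%N -> f i = 0.

(** The junk value [0] for families that do not vanish eventually makes [finsum]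
    total; it is used through [finsumE]. *)
Definition finsum f : W :=
  if pselect (eventually0 f) is left e then \sum_(i < projT1 (cid e)) f i else 0.

Lemma finsumE f N : (forall i, (N <= i)%N -> f i = 0) ->
  finsum f = \sum_(i < N) f i.
Proof.
move=> f0; rewrite /finsum; case: pselect => [e|[]]; last by exists N.
case: cid => N' /= f0'; case: (leqP N N') => [|/ltnW] NN'.
  exact: sum_stab.
by symmetry; apply: sum_stab.
Qed.

Lemma eventually0_lc a f h : eventually0 f -> eventually0 h ->
  eventually0 (fun k => a *: f k + h k).
Proof.
move=> [N fN] [N' hN']; exists (maxn N N') => i; rewrite geq_max => /andP[iN iN'].
by rewrite fN// hN'// scaler0 addr0.
Qed.

Lemma eventually0Z (a : nat -> K) f : eventually0 f -> eventually0 (fun k => a k *: f k).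
Proof. by move=> [N fN]; exists N => i /fN ->; rewrite scaler0. Qed.

Lemma finsum_lc a f h : eventually0 f -> eventually0 h ->
  finsum (fun k => a *: f k + h k) = a *: finsum f + finsum h.
Proof.
move=> [N fN] [N' hN']; pose n := maxn N N'.
have fn i : (n <= i)%N -> f i = 0 by rewrite geq_max => /andP[/fN].
have hn i : (n <= i)%N -> h i = 0 by rewrite geq_max => /andP[_ /hN'].
rewrite (finsumE fn) (finsumE hn) (finsumE (N := n)); last first.
  by move=> i ni; rewrite fn// hn// scaler0 addr0.
by rewrite big_split scaler_sumr.
Qed.

Lemma finsumZ a f : eventually0 f -> finsum (fun k => a *: f k) = a *: finsum f.
Proof.
move=> [N fN]; rewrite (finsumE fN) (finsumE (N := N)) ?scaler_sumr//.
by move=> i /fN ->; rewrite scaler0.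
Qed.

Lemma finsum0 : finsum (fun=> 0) = 0.
Proof. by rewrite (finsumE (N := 0%N))// big_ord0. Qed.

Lemma finsum_sum n (F : nat -> nat -> W) : (forall i, eventually0 (F i)) ->
  finsum (fun k => \sum_(i < n) F i k) = \sum_(i < n) finsum (F i).
Proof.
move=> Ff; suff : eventually0 (fun k => \sum_(i < n) F i k) /\
    finsum (fun k => \sum_(i < n) F i k) = \sum_(i < n) finsum (F i) by case.
elim: n => [|n [ih1 ih2]].
  split; first by exists 0%N => i _; rewrite big_ord0.
  rewrite big_ord0 -[RHS]finsum0; congr finsum.
  by apply/funext => k; rewrite big_ord0.
have -> : (fun k => \sum_(i < n.+1) F i k) =
          (fun k => 1 *: (\sum_(i < n) F i k) + F n k).
  by apply/funext => k; rewrite big_ord_recr scale1r.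
split; first exact: eventually0_lc.
by rewrite finsum_lc// scale1r ih2 big_ord_recr.
Qed.

End FiniteSums.

Section FiniteSumsLinear.
Context (K : pzRingType) (W W' : lmodType K) (L : W -> W') (lL : linear L).

Lemma eventually0_linear f : eventually0 f -> eventually0 (L \o f).
Proof. by move=> [N fN]; exists N => i /fN /= ->; exact: lin0. Qed.

Lemma finsum_linear f : eventually0 f -> L (finsum f) = finsum (L \o f).
Proof.
move=> [N fN]; rewrite (finsumE fN) (lin_sum lL) (finsumE (N := N))//.
by move=> i /fN /= ->; exact: lin0.
Qed.

End FiniteSumsLinear.

(** * A mode that vanishes on the algebra is a scalar on the module *)

Lemma cbin0 (R : realType) i : cbin 0 i = (i == 0%N)%:R :> R[i].
Proof.
case: i => [|i]; first by rewrite /cbin big_ord0 fact0 divr1.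
by rewrite /cbin big_ord_recl subr0 !mul0r.
Qed.

Section CentralModes.
Context (R : realType) (V : lmodType R[i]) (A : vertexAlgebra V).
Context (g : V -> V) (T : nat) (T0 : (0 < T)%N).
Context (M : lmodType R[i]) (YM : twistedModule A g T M).

(** The coefficient [l = m = 0] of the Jacobi identity is the commutator formula
    [[a_0, v_n] = (a_0 v)_n]. *)
Lemma central_mode_comm a : twspace g T 0 a ->
  (forall v, vmode A a 0 v = 0) ->
  forall v n w, tmode YM a 0 (tmode YM v n w) = tmode YM v n (tmode YM a 0 w).
Proof.
move=> ga a0 v n w; apply/eqP; rewrite -subr_eq0; apply/eqP.
have := tmode_jacobi YM T0 ga v w 0 0 n.
rewrite /= mul0r addr0 => /(eqsum_at (N0 := 1%N)).
rewrite !big_ord1 !cbin0 eqxx !subr0 !addr0 !expr0 mul1r !scale1r a0.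
rewrite (lin0 (tmode_linearl YM (0 + n) w)) scaler0.
by apply=> -[//|i] _; rewrite cbin0 ?mulr0 scale0r.
Qed.

End CentralModes.

(** For [u] homogeneous for both gradings the residue defining the product is a
    finite sum, because [Y(u, z) v] is truncated. *)
Lemma star_g_ex (R : realType) (V : lmodType R[i]) (A : vertexAlgebra V)
    (om : V) (g : V -> V) (T r : nat) (n : int) u v : (r < T)%N -> twspace g T r u ->
  wtspace A om n%:~R u -> exists s, star_g A om g T u v s.
Proof.
move=> rT ur un; have [N NP] := vmode_trunc A u v.
case: (eqVneq r 0%N) => [r0|r0]; last first.
  by exists 0; exists r, n; split=> //; rewrite ifN.
exists (\sum_(i < `|N|.+1) cbin n%:~R i *: vmode A u (i%:Z - 1) v).
exists r, n; split=> //; rewrite r0 eqxx.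
near=> K; symmetry.
apply: (sum_stab (f := fun i : nat => cbin n%:~R i *: vmode A u (i%:Z - 1) v)).
  move=> i Ni; rewrite NP ?scaler0//; lia.
near: K; exact: nbhs_infty_ge.
Unshelve. all: by end_near. Qed.

Section Homogeneous.
Context (R : realType) (V : lmodType R[i]) (A : vertexAlgebra V) (om : V).
Hypothesis voaA : voa A om.

Lemma wtspace_subspace n : is_subspace (wtspace A om n).
Proof.
have lL : linear (Lop A om 0) := vmode_linearr A om (0 + 1).
split=> [|a u v uE vE]; rewrite /wtspace/=; first by rewrite (lin0 lL) scaler0.
by rewrite lL uE vE scalerDr !scalerA mulrC.
Qed.

Lemma wtspace_span (P : set V) : is_subspace P ->
  (forall (n : int) v, wtspace A om n%:~R v -> P v) -> forall v, P v.
Proof.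
move=> sP Pwt v; have [[_ _ spV _] int _ _] := voaA.
have : lspan (\bigcup_n wtspace A om n) v by rewrite spV.
apply=> // u [n _ un]; have [->|/eqP u0] := eqVneq u 0; first exact: sP.1.
by have [k nk] := int _ _ un u0; apply: (Pwt k); rewrite -nk.
Qed.

(** The weights are integers and the weight spaces are finite-dimensional, so the
    spans of the weight spaces of weight at most [N] in absolute value exhaust
    [V]. *)
Lemma voa_countable :
  exists S : nat -> seq V, forall v, exists n, lspan [set` S n] v.
Proof.
have [_ _ /choice[s sP] _] := voaA.
pose S N := flatten [seq s (Posz i) ++ s (- Posz i) | i <- iota 0 N].
have mS : forall m n, (m <= n)%N -> lspan [set` S m] `<=` lspan [set` S n].
  move=> m n mn; apply: lspan_mono => x /= /flattenP[e /mapP[i im ->] xi].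
  apply/flattenP; exists (s (Posz i) ++ s (- Posz i)) => //.
  apply/mapP; exists i => //; move: im; rewrite !mem_iota !add0n/= => im.
  exact: leq_trans mn.
exists S; apply: wtspace_span.
  split=> [|a u v [m um] [n vn]]; first by exists 0%N; exact: (lspan_subspace _).1.
  exists (maxn m n); apply: (lspan_subspace _).2.
    exact: (mS _ _ (leq_maxl _ _) _ um).
  exact: (mS _ _ (leq_maxr _ _) _ vn).
move=> n v /sP vn; exists `|n|.+1; apply: lspan_mono vn => x /= xn.
apply/flattenP; exists (s (Posz `|n|) ++ s (- Posz `|n|)).
  by apply/mapP; exists `|n|%N => //; rewrite mem_iota add0n leqnn.
rewrite mem_cat; case: n xn => n xn; first by rewrite absz_nat xn.
by rewrite NegzE abszN absz_nat -NegzE xn orbT.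
Qed.

Context (g : {linear V -> V}) (T : nat).
Hypotheses (autg : voa_aut A om g) (T0 : (0 < T)%N).
Hypothesis gT : forall v, iter T g v = v.

Lemma wtspace_aut n v : wtspace A om n v -> wtspace A om n (g v).
Proof.
have [_ _ gY gom] := autg.
by rewrite /wtspace/= /Lop => vn; rewrite -{1}gom -gY vn linearZ.
Qed.

(** The automorphism fixes [om], so its eigenprojections preserve the weights and
    the two gradings can be diagonalised together. *)
Lemma homogeneous_span (P : set V) : is_subspace P ->
  (forall (r : nat) (n : int) v, (r < T)%N -> twspace g T r v ->
     wtspace A om n%:~R v -> P v) -> forall v, P v.
Proof.
move=> sP Ph; apply: wtspace_span => // n v vn.
rewrite (sum_eigenproj g T0 v); apply: subsp_sum => // r _.
apply: (Ph r n) => //; first exact: eigenproj_twspace.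
apply: eigenproj_stable vn; first exact: wtspace_subspace.
exact: wtspace_aut.
Qed.

End Homogeneous.

Section LowestWeight.
Context (R : realType) (V : lmodType R[i]) (A : vertexAlgebra V) (om : V).
Context (g : {linear V -> V}) (T : nat).
Hypotheses (voaA : voa A om) (autg : voa_aut A om g) (T0 : (0 < T)%N).
Hypothesis gT : forall v, iter T g v = v.
Context (M : lmodType R[i]) (YM : twistedModule A g T M).

(** The orbit of [w] contains [w], the image of the vacuum, and it is stable
    because [o(u) o(v) w = o(u *_g v) w].  Hence [U] is no larger than [V]. *)
Lemma irreducible_cyclic (rho : V -> M -> M) (U : set M) (w : M) :
  irreducible_Ag_module A om g T rho U -> (forall x, linear (rho^~ x)) ->
  U w -> w <> 0 -> U = [set rho v w | v in setT].
Proof.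
move=> [[[sU rU] [_ _] r1 rstar _] _ irr] lr Uw w0.
have lw := lr w.
have sP : is_subspace [set rho v w | v in setT].
  split=> [|a _ _ [u _ <-] [v _ <-]]; first by exists 0; rewrite ?(lin0 lw).
  by exists (a *: u + v) => //; exact: lw.
have [||P0|//] := irr _ sP.
- by move=> _ [v _ <-]; exact: rU.
- move=> u _ [v _ <-]; move: u.
  apply: (homogeneous_span voaA autg T0 gT).
    split=> [|a u u' Pu Pu'] /=; first by rewrite (lin0 (lr _)); exact: sP.1.
    by rewrite (lr _ a u u'); exact: sP.2.
  move=> r n u rT ur un; have [s us] := star_g_ex v rT ur un.
  by exists s => //; exact: rstar us.
- by case: w0; apply: P0; exists (vac A) => //; exact: r1.
Qed.

(** Schur's lemma gives the scalar on the lowest weight space; the vectors on which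
    [a_0] is this scalar form a submodule, which contains generators. *)
Lemma lowest_weight_scalar a : lowest_weight YM om -> twspace g T 0 a ->
  (forall v, vmode A a 0 v = 0) -> exists c, forall w, tmode YM a 0 w = c *: w.
Proof.
move=> [lam [o [_ [lo oE] irr gen]]] ga a0.
pose f := tmode YM a 0; have lf : linear f := tmode_linearr YM a 0.
have fc v n w : f (tmode YM v n w) = tmode YM v n (f w).
  exact: central_mode_comm.
set U := Mspace YM om lam in irr gen.
have fo v w : f (o v w) = o v (f w).
  move: v; apply: (wtspace_span voaA).
    split=> [|b u v fu fv] /=; first by rewrite !(lin0 (lo _)) (lin0 lf).
    by rewrite !(lo _ b u v) lf fu fv.
  by move=> n v vn; rewrite !(oE _ _ vn) fc.
have [[[sU oU] [_ olin] _ _ _] [w0 Uw0 w00] irrP] := irr.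
have fU x : U x -> U (f x).
  by rewrite /U /Mspace/= /LM -fc => ->; exact: (linZ lf).
have [S SP] := voa_countable voaA.
have UE := irreducible_cyclic irr lo Uw0 w00.
have Ucov : U `<=` \bigcup_n lspan [set` map (o^~ w0) (S n)].
  rewrite {1}UE => _ [v _ <-]; have [n vn] := SP v; exists n => //.
  have := lspan_image (lo w0) vn; apply: lspan_mono => _ [u uS <-] /=.
  exact: map_f.
have oZ v t x : U x -> o v (t *: x) = t *: o v x.
  move=> Ux; have := olin v t x 0 Ux sU.1; rewrite !addr0 => ->.
  have := olin v (-1) 0 0 sU.1 sU.1; rewrite scaler0 addr0 scaleN1r addNr => ->.
  by rewrite addr0.
have [||c cP] := schur_countable lf sU fU (ex_intro2 _ _ _ Uw0 w00) Ucov irrP.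
- move=> t v x [Ux fx]; split; first exact: oU.
  by rewrite fo fx oZ.
- move=> t v _ [x Ux <-]; exists (o v x); first exact: oU.
  rewrite fo [in RHS]addrC -[in RHS]scaleNr olin//; last exact: fU.
  by rewrite scaleNr addrC.
exists c => w; have : [set w | f w = c *: w] = setT.
  apply: gen => //; last first.
    by move=> v n x /= fx; rewrite fc fx (linZ (tmode_linearr YM v n)).
  split=> [|b u v /= fu fv]; rewrite /= ?(lin0 lf) ?scaler0//.
  by rewrite lf fu fv scalerDr !scalerA mulrC.
by move/seteqP => -[_ /(_ w)]; exact.
Qed.

End LowestWeight.

(** * Multiplication by an exponential *)

Lemma sum_triangle (W : zmodType) (G : nat -> nat -> W) N :
  \sum_(j < N) \sum_(k < N - j) G j k =
  \sum_(n < N) \sum_(j < n.+1) G j (n - j)%N.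
Proof.
elim: N => [|N ih]; first by rewrite !big_ord0.
rewrite [RHS]big_ord_recr/= -ih [in LHS]big_ord_recr/= subSnn big_ord1.
rewrite [X in _ = _ + X]big_ord_recr/= subnn addrA -big_split/=; congr (_ + _).
by apply: eq_bigr => j _; rewrite subSn 1?ltnW// big_ord_recr.
Qed.

Section ExpCoef.
Context (K : numFieldType).
Definition exp_coef (c : K) (k : nat) : K := c ^+ k / (k`!)%:R.

(** The derivative of [exp(c x)] is [c exp(c x)]. *)
Lemma exp_coefS c k : k.+1%:R * exp_coef c k.+1 = c * exp_coef c k.
Proof.
rewrite /exp_coef factS natrM exprS.
have k0 : k.+1%:R != 0 :> K by rewrite pnatr_eq0.
have kf0 : (k`!)%:R != 0 :> K by rewrite pnatr_eq0 -lt0n fact_gt0.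
move: k.+1%:R k`!%:R k0 kf0 => x y x0 y0.
by field; rewrite x0 y0.
Qed.

(** The binomial theorem, as the Cauchy product of [exp(a x)] and [exp(b x)]. *)
Lemma exp_coefD a b n :
  \sum_(j < n.+1) exp_coef a j * exp_coef b (n - j) = exp_coef (a + b) n.
Proof.
have f0 k : (k`!)%:R != 0 :> K by rewrite pnatr_eq0 -lt0n fact_gt0.
rewrite /exp_coef [a + b]addrC exprDn mulr_suml; apply: eq_bigr => j _.
have jn : (j <= n)%N by rewrite -ltnS.
rewrite -(bin_fact jn) !natrM -mulr_natr.
have b0 : 'C(n, j)%:R != 0 :> K by rewrite pnatr_eq0 -lt0n bin_gt0.
by field; rewrite b0 !f0.
Qed.

Lemma exp_coef0 k : exp_coef 0 k = (k == 0%N)%:R.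
Proof. by rewrite /exp_coef expr0n; case: k => [|k]; rewrite ?divr1// mul0r. Qed.

End ExpCoef.

Section Truncation.
Context (R : realType) (V : lmodType R[i]) (A : vertexAlgebra V).
Context (g : {linear V -> V}) (T : nat) (T0 : (0 < T)%N).
Hypothesis gT : forall v, iter T g v = v.
Context (M : lmodType R[i]) (YM : twistedModule A g T M).

(** Truncation for arbitrary vectors and arbitrary exponents: each eigencomponent of
    [v] either has its modes in the coset [h + Z], where truncation applies, or has
    no mode there at all. *)
Lemma tmode_eventually0 v h w : eventually0 (fun i => tmode YM v (h + i%:R) w).
Proof.
have lv n := tmode_linearl YM n w.
have /choice[N NP] (r : 'I_T) : exists N, forall i, (N <= i)%N ->
    tmode YM (eigenproj g T r v) (h + i%:R) w = 0.
  have tr := eigenproj_twspace T0 gT r v.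
  have [[k hk]|hk] := pselect (exists k : int, h = r%:R / T%:R + k%:~R).
    have [N NP] := tmode_trunc YM (ltn_ord r) tr w.
    exists `|N - k|%N => i Ni.
    have -> : h + i%:R = r%:R / T%:R + (k + i%:Z)%:~R.
      by rewrite hk intrD addrA.
    apply: NP; lia.
  exists 0%N => i _; apply: (tmode_support YM (ltn_ord r) tr) => k hik.
  apply: hk; exists (k - i%:Z); apply: (addIr i%:R).
  by rewrite hik intrB -addrA subrK.
exists (\max_r N r) => i Ni.
rewrite (sum_eigenproj g T0 v) (lin_sum (lv _)) big1// => r _; apply: NP.
by rewrite (leq_trans _ Ni)// leq_bigmax.
Qed.
End Truncation.

Section Twist.
Context (R : realType) (M1 M2 M3 : lmodType R[i]).
Implicit Types (c : R[i]) (I J : M1 -> R[i] -> M2 -> M3).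

(** The coefficient of [x^(-h-1)] in [exp(c x) I(w1, x) w2]. *)
Definition exp_twist c I : M1 -> R[i] -> M2 -> M3 :=
  fun w1 h w2 => finsum (fun k => exp_coef c k *: I w1 (h + k%:R) w2).

Definition truncated I :=
  forall w1 h w2, eventually0 (fun k => I w1 (h + k%:R) w2).

Lemma exp_twist0 I : exp_twist 0 I = I.
Proof.
apply/funext => w1; apply/funext => h; apply/funext => w2.
rewrite /exp_twist (finsumE (N := 1%N)).
  by rewrite big_ord1 exp_coef0 scale1r addr0.
by move=> [//|k] _; rewrite exp_coef0 scale0r.
Qed.

Lemma exp_twistD a b I : truncated I ->
  exp_twist a (exp_twist b I) = exp_twist (a + b) I.
Proof.
move=> tI; apply/funext => w1; apply/funext => h; apply/funext => w2.
have [N IN] := tI w1 h w2; pose F k := I w1 (h + k%:R) w2.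
have JE j : exp_twist b I w1 (h + j%:R) w2 = \sum_(k < N - j) exp_coef b k *: F (j + k)%N.
  rewrite /exp_twist (finsumE (N := (N - j)%N)) => [|k]; last first.
    by rewrite leq_subLR => jk; rewrite -addrA -natrD IN// scaler0.
  by apply: eq_bigr => k _; rewrite /F natrD addrA.
rewrite {1}/exp_twist (finsumE (N := N)) => [|j Nj]; last first.
  by rewrite JE (eqP Nj) big_ord0 scaler0.
rewrite [RHS]/exp_twist [RHS](finsumE (N := N)) => [|j Nj]; last by rewrite IN// scaler0.
under eq_bigr do rewrite JE scaler_sumr.
rewrite (sum_triangle (fun j k => exp_coef a j *: (exp_coef b k *: F (j + k)%N))).
apply: eq_bigr => n _; rewrite -/(F n) -exp_coefD scaler_suml.
apply: eq_bigr => j _; rewrite scalerA subnKC//.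
by rewrite -ltnS.
Qed.

Lemma exp_twist_lc a c I J : truncated I -> truncated J ->
  exp_twist c (a *: I + J) = a *: exp_twist c I + exp_twist c J.
Proof.
move=> tI tJ; apply/funext => w1; apply/funext => h; apply/funext => w2.
transitivity (a *: exp_twist c I w1 h w2 + exp_twist c J w1 h w2); last by [].
rewrite /exp_twist -finsum_lc; [|exact: eventually0Z..]; congr finsum.
by apply/funext => k; rewrite -[(a *: I + J) _ _ _]/(a *: I _ _ _ + J _ _ _)
  scalerDr !scalerA mulrC.
Qed.

End Twist.

Section TwistedIntertwining.
Context (R : realType) (V : lmodType R[i]) (A : vertexAlgebra V).
Context (om om' : V) (g1 g2 g3 : {linear V -> V}) (T T1 T2 T3 : nat).
Context (M1 M2 M3 : lmodType R[i]).
Context (Y1 : twistedModule A g1 T1 M1).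
Context (Y2 : twistedModule A g2 T2 M2).
Context (Y3 : twistedModule A g3 T3 M3).
Hypotheses (T10 : (0 < T1)%N) (T20 : (0 < T2)%N).
Hypotheses (gT1 : forall v, iter T1 g1 v = v) (gT2 : forall v, iter T2 g2 v = v).
Implicit Types (c : R[i]) (I J : M1 -> R[i] -> M2 -> M3).

Lemma intertwining_truncated om0 I : intertwining om0 T Y1 Y2 Y3 I -> truncated I.
Proof.
move=> [_ tI _ _] w1 h w2; have [N NP] := tI w1 w2 h.
exists (Num.bound `|N|) => k Nk; rewrite -ratr_nat; apply: NP.
apply: le_trans (ler_norm _) _; apply: le_trans (ltW (archi_boundP (normr_ge0 N))) _.
by rewrite ler_nat.
Qed.

(** Multiplying by [exp(c x2)] replaces the coefficient of index [n] by the sum over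
    [k] of [c^k / k!] times the coefficient of index [n + k].  Each of these is an
    identity between sums over [i], to be summed over [k]; the two summations may
    be exchanged because the bound [N0] on [i] is uniform in [k]. *)
Lemma iop_jacobi_twist c I : truncated I ->
  (forall h w2, linear (fun w1 => I w1 h w2)) -> (forall w1 h, linear (I w1 h)) ->
  iop_jacobi T Y1 Y2 Y3 I -> iop_jacobi T Y1 Y2 Y3 (exp_twist c I).
Proof.
move=> tI lI1 lI2 jI j1 j2 v v1 v2 w1 w2 k0 m n l.
set cs := cis _ * _.
(* The terms of the two sides, as functions of the exponent [n] of [x2] and of
   the summation index. *)
pose L n i := ((-1) ^+ i * cbin l i) *:
  (tmode Y3 v (m + l - i%:R) (I w1 (n + i%:R) w2)
   - cs *: I w1 (n + l - i%:R) (tmode Y2 v (m + i%:R) w2)).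
pose Q n i := if `[< exists k' : int, m = j2%:~R / T%:R + k'%:~R >]
  then cbin m i *: I (tmode Y1 v (l + i%:R) w1) (m + n - i%:R) w2 else 0.
have lY3 p := tmode_linearr Y3 v p.
have [Na NaP] := tI w1 n w2.
have [Nb NbP] := tmode_eventually0 T20 gT2 Y2 v m w2.
have [Nc NcP] := tmode_eventually0 T10 gT1 Y1 v l w1.
pose N0 := maxn Na (maxn Nb Nc).
(* Shifting [n] by [k] only moves [I w1 (n + i)] further into its truncation
   range, and the other two bounds do not involve [n]. *)
have LN0 k i : (N0 <= i)%N -> L (n + k%:R) i = 0.
  rewrite !geq_max => /and3P[ai bi _].
  rewrite /L NbP// (lin0 (lI2 _ _)) -(addrA n) -natrD NaP.
    by rewrite (lin0 (lY3 _)) scaler0 subr0 scaler0.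
  by rewrite (leq_trans ai)// leq_addl.
have QN0 k i : (N0 <= i)%N -> Q (n + k%:R) i = 0.
  rewrite !geq_max => /and3P[_ _ ci].
  by rewrite /Q NcP// (lin0 (lI1 _ _)) scaler0 if_same.
pose u i := tmode Y2 v (m + i%:R) w2.
pose f1 i k := I w1 (n + i%:R + k%:R) w2.
pose f2 i k := I w1 (n + l - i%:R + k%:R) (u i).
pose f3 i k := I (tmode Y1 v (l + i%:R) w1) (m + n - i%:R + k%:R) w2.
have LE i k : L (n + k%:R) i = ((-1) ^+ i * cbin l i) *:
    (- cs *: f2 i k + tmode Y3 v (m + l - i%:R) (f1 i k)).
  rewrite /L /f1 /f2 /u scaleNr [in RHS]addrC.
  by congr (_ *: (tmode _ _ _ (I _ _ _) - _ *: I _ _ _)); ring.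
have QE i k : Q (n + k%:R) i =
    (if `[< exists k' : int, m = j2%:~R / T%:R + k'%:~R >] then cbin m i else 0)
    *: f3 i k.
  rewrite /Q /f3; case: ifP => _; last by rewrite scale0r.
  by congr (_ *: I _ _ _); ring.
have Lf i : eventually0 (fun k => L (n + k%:R) i).
  rewrite (funext (LE i)); apply: (eventually0Z (fun=> _)).
  by apply: eventually0_lc; [exact: tI|exact: (eventually0_linear (lY3 _) (tI _ _ _))].
have Qf i : eventually0 (fun k => Q (n + k%:R) i).
  by rewrite (funext (QE i)); apply: (eventually0Z (fun=> _)); exact: tI.
exists N0 => // N /= N0N.
transitivity (\sum_(i < N) finsum (fun k => exp_coef c k *: L (n + k%:R) i)).
  apply: eq_bigr => i _; rewrite /exp_twist -/(u i).
  rewrite (finsum_linear (lY3 _)); last by apply: eventually0Z; exact: tI.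
  rewrite addrC -scaleNr -finsum_lc.
  - rewrite -finsumZ; first congr finsum.
      apply/funext => k; rewrite LE -/(f2 i k) /= (linZ (lY3 _)) -/(f1 i k).
      by rewrite !scalerA !scalerDr !scalerA; congr (_ *: _ + _ *: _); ring.
    apply: eventually0_lc; first by apply: eventually0Z; exact: tI.
    by apply: (eventually0_linear (lY3 _)); apply: eventually0Z; exact: tI.
  - by apply: eventually0Z; exact: tI.
  - by apply: (eventually0_linear (lY3 _)); apply: eventually0Z; exact: tI.
transitivity (\sum_(i < N) finsum (fun k => exp_coef c k *: Q (n + k%:R) i)); last first.
  apply: eq_bigr => i _; rewrite /exp_twist.
  transitivity ((if `[< exists k' : int, m = j2%:~R / T%:R + k'%:~R >]
    then cbin m i else 0) *: finsum (fun k => exp_coef c k *: f3 i k)).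
    rewrite -finsumZ; last by apply: eventually0Z; exact: tI.
    by congr finsum; apply/funext => k; rewrite QE !scalerA mulrC.
  by case: ifP => _ //; rewrite scale0r.
have Lf' i := eventually0Z (exp_coef c) (Lf i); have Qf' i := eventually0Z (exp_coef c) (Qf i).
rewrite -(finsum_sum N Lf') -(finsum_sum N Qf').
congr finsum; apply/funext => k; rewrite -!scaler_sumr; congr (_ *: _).
apply: eqsum_at; [| |exact: jI].
- by move=> i Ni; apply: LN0; exact: leq_trans Ni.
- by move=> i Ni; apply: QN0; exact: leq_trans Ni.
Qed.

Lemma intertwining_twist c I :
  (forall w, LM Y1 om' (- 1) w = LM Y1 om (- 1) w + c *: w) ->
  intertwining om T Y1 Y2 Y3 I -> intertwining om' T Y1 Y2 Y3 (exp_twist c I).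
Proof.
move=> omc iI; have tI := intertwining_truncated iI.
have [[lI1 lI2] trI jI dI] := iI; split.
- split=> [h w2 a u v|w1 h a u v]; rewrite /exp_twist -finsum_lc;
    try exact: eventually0Z; congr finsum; apply/funext => k.
    by rewrite (lI1 _ w2 a u v) scalerDr !scalerA mulrC.
  by rewrite (lI2 w1 _ a u v) scalerDr !scalerA mulrC.
- move=> w1 w2 h; have [N NP] := trI w1 w2 h; exists N => n Nn.
  rewrite /exp_twist -[RHS](finsum0 M3); congr finsum; apply/funext => k.
  rewrite -addrA -(ratr_nat _ k) -rmorphD NP ?scaler0//.
  by rewrite (le_trans Nn)// lerDl.
- exact: iop_jacobi_twist.
(* The product rule: the difference of the two sides telescopes. *)
move=> w1 h w2; pose F k := I w1 (h - 1 + k%:R) w2.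
have [N FN] : eventually0 F := tI w1 (h - 1) w2.
have FN' k : (N <= k)%N -> F k.+1 = 0 by move=> Nk; apply: FN; exact: leqW.
have Fk k : I w1 (h + k%:R - 1) w2 = F k by rewrite /F addrAC.
have FSk k : I w1 (h + k%:R) w2 = F k.+1.
  by rewrite /F -natr1 addrACA addNr addr0.
have IE k : I (LM Y1 om' (- 1) w1) (h + k%:R) w2 =
    - (h + k%:R) *: F k + c *: F k.+1.
  by rewrite omc (linD (lI1 _ w2)) dI (linZ (lI1 _ w2)) Fk FSk.
rewrite /exp_twist (finsumE (N := N)) => [|k Nk]; last first.
  by rewrite IE FN// FN'// !scaler0 addr0 scaler0.
rewrite [X in _ = _ *: X](finsumE (N := N)) => [|k Nk]; last first.
  by rewrite -/(F k) FN// scaler0.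
apply/eqP; rewrite -subr_eq0 scaler_sumr -sumrB; apply/eqP.
pose G k := (k%:R * exp_coef c k) *: F k.
transitivity (\sum_(0 <= k < N) (G k.+1 - G k)).
  rewrite big_mkord; apply: eq_bigr => k _.
  rewrite IE -/(F k) /G exp_coefS scalerDr !scalerA addrAC -scalerBl addrC.
  rewrite -[in RHS]scaleNr [exp_coef c k * c]mulrC; congr (_ + _ *: _).
  by ring.
by rewrite telescope_sumr// /G FN// scaler0 mul0r scale0r subr0.
Qed.

End TwistedIntertwining.

(** * The isomorphism *)

Theorem theorem4p7 (R : realType) (V : lmodType R[i]) (A : vertexAlgebra V)
    (om om' : V) (g1 g2 g3 : {linear V -> V}) (T1 T2 T3 T : nat)
    (W1 W2 W3 : lmodType R[i])
    (Y1 : twistedModule A g1 T1 W1)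
    (Y2 : twistedModule A g2 T2 W2)
    (Y3 : twistedModule A g3 T3 W3) :
  voa A om -> voa A om' ->
  voa_aut A om g1 -> voa_aut A om g2 -> voa_aut A om g3 ->
  voa_aut A om' g1 -> voa_aut A om' g2 -> voa_aut A om' g3 ->
  (forall v, g1 (g2 v) = g2 (g1 v)) ->
  (forall v, g1 (g3 v) = g3 (g1 v)) ->
  (forall v, g2 (g3 v) = g3 (g2 v)) ->
  has_order g1 T1 -> has_order g2 T2 -> has_order g3 T3 ->
  (0 < T)%N ->
  (forall v, iter T g1 v = v) ->
  (forall v, iter T g2 v = v) ->
  (forall v, iter T g3 v = v) ->
  lowest_weight Y1 om ->
  exists (c : R[i])
    (phi : {linear iop_space om T Y1 Y2 Y3 -> iop_space om' T Y1 Y2 Y3}),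
    [/\ bijective phi,
        forall w : W1, LM Y1 om' (- 1) w = LM Y1 om (- 1) w + c *: w
      & forall (I : iop_space om T Y1 Y2 Y3) (w1 : W1) (h : R[i]) (w2 : W2),
          \forall N \near \oo,
            phi I w1 h w2 =
              \sum_(k < N) (c ^+ k / (k`!)%:R) *: I w1 (h + k%:R) w2].
Proof.
move=> voaom voaom' aut1 _ _ aut1' _ _ _ _ _ [T10 gT1 _] [T20 gT2 _] _ _ _ _ _ lw.
have ga : twspace g1 T1 0 (om' - om).
  have [_ _ _ gom] := aut1; have [_ _ _ gom'] := aut1'.
  by rewrite /twspace/= linearB/= gom gom' mulr0 mul0r oppr0 cis0 scale1r.
have a0 v : vmode A (om' - om) 0 v = 0.
  have [[_ D _ _] _ _ _] := voaom; have [[_ D' _ _] _ _ _] := voaom'.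
  rewrite (linB (vmode_linearl A 0 v)); apply/eqP; rewrite subr_eq0; apply/eqP.
  exact: etrans (D' v) (esym (D v)).
have [c cP] := lowest_weight_scalar voaom aut1 T10 gT1 lw ga a0.
have omc w : LM Y1 om' (- 1) w = LM Y1 om (- 1) w + c *: w.
  rewrite -cP (linB (tmode_linearl Y1 0 w)) addrC.
  by rewrite /LM addNr -[X in _ + X]/(tmode Y1 om 0 w) subrK.
have omc' w : LM Y1 om (- 1) w = LM Y1 om' (- 1) w + (- c) *: w.
  by rewrite omc scaleNr addrK.
have iopP o0 (I : iop_space o0 T Y1 Y2 Y3) : intertwining o0 T Y1 Y2 Y3 I.
  by case: I => I /= /asboolP.
have twP (I : iop_space om T Y1 Y2 Y3) :
    exp_twist c I \in iop_pred om' T Y1 Y2 Y3.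
  by apply/asboolP; exact: intertwining_twist omc (iopP _ I).
have twP' (I : iop_space om' T Y1 Y2 Y3) :
    exp_twist (- c) I \in iop_pred om T Y1 Y2 Y3.
  by apply/asboolP; exact: intertwining_twist omc' (iopP _ I).
pose phi I := IopSpace (twP I).
pose psi I := IopSpace (twP' I).
have trI o0 (I : iop_space o0 T Y1 Y2 Y3) : truncated I.
  exact: intertwining_truncated (iopP _ I).
have phi_lin : linear phi.
  by move=> a I J; apply: val_inj; rewrite /= exp_twist_lc.
pose phiL : {linear iop_space om T Y1 Y2 Y3 -> iop_space om' T Y1 Y2 Y3} :=
  HB.pack phi (GRing.isLinear.Build _ _ _ _ phi phi_lin).
exists c, phiL; split=> [|//|I w1 h w2].
  exists psi => I; apply: val_inj; rewrite /= exp_twistD//.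
    by rewrite addNr exp_twist0.
  by rewrite subrr exp_twist0.
have [N NP] := trI _ I w1 h w2; exists N => // n /= Nn.
rewrite /exp_twist (finsumE (N := n))// => k nk.
by rewrite NP ?scaler0// (leq_trans Nn).
Qed.
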